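(* Let $\sigma=(\sigma_1,\dots,\sigma_d)\in C^\infty(\mathbb R^n,\mathbb R^n\otimes(\mathbb R^d)^* )$, $z_1,z_2\in\mathbb R^n$, $m\ge0$, $\tau\in\mathcal T$, and let $\mathbb X:\mathcal F^{\le m}\to\mathbb R$ be a multiplicative functional. Set $z^{[j+1]}:=z_2-z_1-\sum_{\tau'\in\mathcal T^{\le j}}\Upsilon_{\tau'}(z_1)\mathbb X(\tau')\in\mathbb R^n$ for $j\ge0$ (so $z^{[1]}=z_2-z_1$). Then $$\Upsilon_\tau(z_2)-\sum_{w\in\mathcal F^{\le m}}\frac{\Upsilon_{w\curvearrowright\tau}(z_1)}{\pi(w)}\,\mathbb X(w)=\sum_{k=0}^m\ \sum_{w=\tau_1\cdots\tau_k\in\mathcal F^{\le m}}\int_0^1\nabla^{k+1}\Upsilon_\tau(z_1+rz^{[1]})\cdot z^{[m+1-|w|]}\,\frac{[\Upsilon\mathbb X]^w}{\pi(w)}\,(1-r)^k\,dr,$$ where the inner sum runs over forests $w\in\mathcal F^{\le m}$ consisting of exactly $k$ trees, $[\Upsilon\mathbb X]^w:=\bigotimes_{i=1}^k\Upsilon_{\tau_i}(z_1)\mathbb X(\tau_i)$, and the $k+1$ derivative indices of $\nabla^{k+1}\Upsilon_\tau$ are contracted with $z^{[m+1-|w|]}$ and the $k$ vectors $\Upsilon_{\tau_i}(z_1)\mathbb X(\tau_i)$.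
   Context: Trees. $\mathcal T$ is the set of finite non-planar rooted trees with vertices decorated by $\{1,\dots,d\}$; $|\tau|$ is the number of vertices. $\mathcal F$ is the set of forests, i.e. finite commutative products (multisets) of trees, including the empty forest $\mathbf 1$; $|w|$ is the total number of vertices. $\mathcal T^{\le m},\mathcal F^{\le m}$ are the subsets of elements with at most $m$ vertices. $[w]_i$ is the tree obtained by joining the roots of the trees of $w$ to a new root decorated by $i$; $\bullet_i=[\mathbf 1]_i$. If $w=\tau_1^{n_1}\cdots\tau_k^{n_k}$ with distinct $\tau_i$, $\pi(w):=\prod_i n_i!$. Grafting. $\tau\curvearrowright\mathbf 1=0$, $\tau\curvearrowright[w]_i=[\tau w+\tau\curvearrowright w]_i$, $\tau\curvearrowright(\tau_1\cdots\tau_k)=\sum_i\tau_1\cdots(\tau\curvearrowright\tau_i)\cdots\tau_k$ (extended linearly), and (Guin-Oudom) $\mathbf 1\curvearrowright\tau=\tau$, $(\tau_1\cdots\tau_k)\curvearrowright\tau=\tau_1\curvearrowright((\tau_2\cdots\tau_k)\curvearrowright\tau)-(\tau_1\curvearrowright(\tau_2\cdots\tau_k))\curvearrowright\tau$. Elementary differentials. $\Upsilon_{\bullet_j}=\sigma_j:\mathbb R^n\to\mathbb R^n$, $\Upsilon_{[\tau_1\cdots\tau_k]_j}=\sum_{i_1,\dots,i_k}\partial_{i_1}\cdots\partial_{i_k}\sigma_j\,\Upsilon_{\tau_1}^{i_1}\cdots\Upsilon_{\tau_k}^{i_k}$, extended linearly to linear combinations of trees. A multiplicative functional $\mathbb X:\mathcal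 F^{\le m}\to\mathbb R$ satisfies $\mathbb X(\mathbf 1)=1$ and $\mathbb X(w_1w_2)=\mathbb X(w_1)\mathbb X(w_2)$ whenever $w_1w_2\in\mathcal F^{\le m}$. *)

(* Defs.v *)
From HB Require Import structures.
From mathcomp Require Import all_boot all_order all_algebra ssrAC.
From mathcomp Require Import all_classical all_reals all_analysis.
From mathcomp Require Import finmap multiset freeg.
Set Implicit Arguments.
Unset Strict Implicit.
Unset Printing Implicit Defensive.
Import Order.TTheory GRing.Theory Num.Theory.
Import numFieldNormedType.Exports.
Local Open Scope ring_scope.
Local Open Scope mset_scope.

Inductive planar (d : nat) := PNode of 'I_d & seq (planar d).

Section Planar.
Context {d : nat}.

Lemma planar_ind' (P : planar d -> Prop) :
  (forall i cs, foldr (fun c Q => P c /\ Q) True cs -> P (PNode i cs)) ->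
  forall t, P t.
Proof.
move=> IH; fix loop 1 => -[i cs]; apply: IH.
by elim: cs => [|c cs IHcs]; [exact: Logic.I | split; [exact: (loop c) | exact: IHcs]].
Qed.

Fixpoint planar_encode (t : planar d) : GenTree.tree unit :=
  let: PNode i cs := t in GenTree.Node i (map planar_encode cs).

Fixpoint planar_decode (t : GenTree.tree unit) : option (planar d) :=
  if t is GenTree.Node k ts then
    omap (fun i => PNode i (pmap planar_decode ts)) (insub k)
  else None.

Lemma planar_encodeK : pcancel planar_encode planar_decode.
Proof.
elim/planar_ind' => i cs IH /=; rewrite valK /=; congr (Some (PNode i _)).
by elim: cs IH => [//|c cs IHcs] /= [-> /= /IHcs ->].
Qed.

HB.instance Definition _ := Countable.copy (planar d) (pcan_type planar_encodeK).

Definition planar_le : rel (planar d) := fun s t => (choice.pickle s <= choice.pickle t)%N.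

Fixpoint planar_sorted (t : planar d) : bool :=
  let: PNode _ cs := t in sorted planar_le cs && all planar_sorted cs.

Fixpoint planar_size (t : planar d) : nat :=
  let: PNode _ cs := t in (sumn (map planar_size cs)).+1.

Lemma planar_le_total : total planar_le.
Proof. by move=> s t; apply: leq_total. Qed.

Lemma planar_le_trans : transitive planar_le.
Proof. by move=> s t u; apply: leq_trans. Qed.

Lemma planar_le_anti : antisymmetric planar_le.
Proof.
by move=> s t /anti_leq /(congr1 (@choice.unpickle (planar d))); rewrite !choice.pickleK => -[].
Qed.
End Planar.

(* A non-planar tree is represented by its unique planar embedding in which the
   children of every vertex are sorted; [tree] inherits decidable equality. *)
Record tree (d : nat) := Tree { planar_of : planar d; _ : planar_sorted planar_of }.

HB.instance Definition _ (d : nat) := [isSub for @planar_of d].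
HB.instance Definition _ (d : nat) := [Countable of tree d by <:].

Notation forest d := ({mset (tree d)})%mset.

Section Trees.
Context {d : nat}.
Implicit Types (t u : tree d) (w : forest d) (i : 'I_d).

Definition troot t : 'I_d := let: PNode i _ := planar_of t in i.

Definition children t : forest d :=
  let: PNode _ cs := planar_of t in seq_mset (pmap insub cs).

Definition node_planar i w : planar d :=
  PNode i (sort planar_le (map (@planar_of d) (enum_mset w))).

Lemma node_planar_sorted i w : planar_sorted (node_planar i w).
Proof.
rewrite /= (sort_sorted (@planar_le_total d)) all_sort /=.
by apply/allP=> _ /mapP[t _ ->]; apply: (valP t).
Qed.

Definition node i w : tree d := Tree (node_planar_sorted i w).

Definition nvert t : nat := planar_size (planar_of t).

Definition fvert w : nat := (\sum_(t <- w) nvert t)%N.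

Lemma troot_node i w : troot (node i w) = i. Proof. by []. Qed.

Lemma children_node i w : children (node i w) = w.
Proof.
rewrite -[RHS]seq_mset_id /children /=; apply/eq_seq_msetP.
have -> : enum_mset w = pmap (insub : _ -> option (tree d)) (map (@planar_of d) (enum_mset w)).
  by elim: (enum_mset w) => [//|t s IH] /=; rewrite (valK t) /= -IH.
apply: perm_pmap; rewrite perm_sort.
by elim: (enum_mset w) => [//|t s IH] /=; rewrite (valK t) /= perm_cons.
Qed.

Lemma node_troot_children t : node (troot t) (children t) = t.
Proof.
case: t => -[i cs] ht; apply: val_inj => /=; have /andP[scs acs] := ht.
rewrite /node_planar /troot /children /=; congr PNode.
apply: (@sorted_eq _ planar_le) => //.
- exact: planar_le_trans.
- exact: planar_le_anti.
- exact: (sort_sorted (@planar_le_total d)).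
rewrite perm_sort.
apply: (@perm_trans _ (map (@planar_of d) (pmap insub cs))).
  exact/perm_map/perm_eq_seq_mset.
rewrite (_ : map _ _ = cs) //.
elim: cs acs {scs ht} => [//|c cs IH] /= /andP[hc hcs].
by rewrite (insubT (@planar_sorted d) hc) /= IH.
Qed.

Lemma nvert_node i w : nvert (node i w) = (fvert w).+1.
Proof.
rewrite /nvert /fvert /= sumnE big_map; congr _.+1.
by rewrite (perm_big (map (@planar_of d) (enum_mset w))) ?perm_sort //= big_map.
Qed.

Lemma fvertD w1 w2 : fvert (w1 `+` w2) = (fvert w1 + fvert w2)%N.
Proof.
rewrite /fvert -big_cat /=; apply: perm_big; apply/allP => t _ /=.
by rewrite count_cat !count_mem_mset msetE2.
Qed.

Lemma nvert_gt0 t : (0 < nvert t)%N.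
Proof. by rewrite -[t]node_troot_children nvert_node. Qed.

Lemma nvert_child t u : u \in children t -> (nvert u < nvert t)%N.
Proof.
move=> ut; rewrite -[t]node_troot_children nvert_node ltnS.
by rewrite /fvert (big_rem u) //= leq_addr.
Qed.

Lemma tree_ind (P : tree d -> Prop) :
  (forall i w, (forall u, u \in w -> P u) -> P (node i w)) -> forall t, P t.
Proof.
move=> IH t; have [n] := ubnP (nvert t); elim: n t => // n IHn t ltn.
rewrite -[t]node_troot_children; apply: IH => u /nvert_child ltu.
by apply: IHn; apply: leq_trans ltu _.
Qed.

End Trees.

Section FreeModule.
Context {R : comNzRingType} {K : choiceType}.
Implicit Types x y : {freeg K / R}.

Section Lift.
Context {M : lmodType R}.
Implicit Types f g : K -> M.

Lemma fgliftB f : {morph fglift f : x y / x - y}.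
Proof. exact: lift_is_additive. Qed.

Lemma fglift0 f : fglift f 0 = 0.
Proof. by rewrite -[0 in LHS](subrr 0) fgliftB subrr. Qed.

Lemma fgliftD f : {morph fglift f : x y / x + y}.
Proof.
move=> x y; rewrite -[y in LHS]opprK fgliftB; congr (_ + _).
by rewrite -[- y]sub0r fgliftB fglift0 sub0r opprK.
Qed.

Lemma fglift_sum f (I : Type) (r : seq I) (F : I -> {freeg K / R}) :
  fglift f (\sum_(i <- r) F i) = \sum_(i <- r) fglift f (F i).
Proof. exact: (big_morph _ (fgliftD f) (fglift0 f)). Qed.

Lemma fglift1 f k : fglift f << k >> = f k.
Proof. by rewrite liftU scale1r. Qed.

Lemma fglift_dom f x : fglift f x = \sum_(k <- dom x) coeff k x *: f k.
Proof.
rewrite -[x in LHS]freeg_sumE fglift_sum.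
by apply: eq_bigr => k _; rewrite liftU.
Qed.

Lemma fgliftZ f c x : fglift f (c *: x) = c *: fglift f x.
Proof.
rewrite -[x in LHS]freeg_sumE scaler_sumr fglift_sum fglift_dom scaler_sumr.
apply: eq_bigr => k _; rewrite (_ : c *: _ = << c * coeff k x *g k >>) ?liftU ?scalerA //.
by apply/eqP/freeg_eqP => l; rewrite coeffZ !coeffU mulrA.
Qed.

Lemma eq_fglift f g x : f =1 g -> fglift f x = fglift g x.
Proof. by move=> fg; rewrite !fglift_dom; apply: eq_bigr => k _; rewrite fg. Qed.

Lemma fglift_addf f g x : fglift (fun k => f k + g k) x = fglift f x + fglift g x.
Proof. by rewrite !fglift_dom -big_split; apply: eq_bigr => k _; rewrite scalerDr. Qed.

Lemma fglift_subf f g x : fglift (fun k => f k - g k) x = fglift f x - fglift g x.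
Proof.
rewrite !fglift_dom -sumrB; apply: eq_bigr => k _.
by rewrite scalerBr.
Qed.

Lemma fglift_sumf (I : Type) (r : seq I) (F : I -> K -> M) x :
  fglift (fun k => \sum_(i <- r) F i k) x = \sum_(i <- r) fglift (F i) x.
Proof.
elim: r => [|i r IH].
  rewrite big_nil fglift_dom big1 // => k _; by rewrite big_nil scaler0.
rewrite big_cons -IH -fglift_addf; apply: eq_fglift => k.
by rewrite big_cons.
Qed.

End Lift.
End FreeModule.

Lemma fglift_comp {R : comNzRingType} {K L : choiceType} {M : lmodType R}
    (f : L -> M) (g : K -> {freeg L / R}) (x : {freeg K / R}) :
  fglift f (fglift g x) = fglift (fun k => fglift f (g k)) x.
Proof.
rewrite (fglift_dom g) fglift_sum [RHS]fglift_dom.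
by apply: eq_bigr => k _; rewrite fgliftZ.
Qed.

Lemma fglift_swap {R : comNzRingType} {K L : choiceType} {M : lmodType R}
    (f : K -> L -> M) (x : {freeg K / R}) (y : {freeg L / R}) :
  fglift (fun k => fglift (f k) y) x = fglift (fun l => fglift (f^~ l) x) y.
Proof.
rewrite (eq_fglift _ (fun k => fglift_dom (f k) y)) fglift_sumf.
rewrite [RHS]fglift_dom; apply: eq_bigr => l _.
by rewrite !fglift_dom scaler_sumr; apply: eq_bigr => k _; rewrite !scalerA mulrC.
Qed.

Section Grafting.
Context {d : nat} {R : comNzRingType}.
Implicit Types (s t u : tree d) (v w : forest d) (i : 'I_d).

(* The linear extension of w |-> [w]_i. *)
Definition node_lin i : {freeg (forest d) / R} -> {freeg (tree d) / R} :=
  fglift (fun w => << node i w >>).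

Fixpoint graft_rec (n : nat) s t : {freeg (tree d) / R} :=
  if n is n'.+1 then
    let w := children t in
    node_lin (troot t)
      (<< s +` w >> +
       \sum_(u <- w) fglift (fun u' => << u' +` (w `\ u) >>) (graft_rec n' s u))
  else 0.

(* The vertex count bounds the recursion depth; see [graft_node]. *)
Definition graft s t : {freeg (tree d) / R} := graft_rec (nvert t) s t.

Definition graft_forest s w : {freeg (forest d) / R} :=
  \sum_(u <- w) fglift (fun u' => << u' +` (w `\ u) >>) (graft s u).

Lemma graft_rec_irr n m s t : (nvert t <= n)%N -> (nvert t <= m)%N ->
  graft_rec n s t = graft_rec m s t.
Proof.
elim: n m t => [m t|n IH [|m] t]; first by rewrite leqNgt nvert_gt0.
  by rewrite [(nvert t <= 0)%N]leqNgt nvert_gt0.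
move=> lt_tn lt_tm /=; congr (node_lin _ (_ + _)).
rewrite big_seq [RHS]big_seq; apply: eq_bigr => u /nvert_child lt_ut.
by rewrite (IH m) // -ltnS; apply: leq_trans lt_ut _.
Qed.

Lemma graft_node s i w :
  graft s (node i w) = node_lin i (<< s +` w >> + graft_forest s w).
Proof.
rewrite {1}/graft nvert_node /= troot_node children_node.
congr (fglift _ (_ + _)); rewrite /graft_forest big_seq [RHS]big_seq.
apply: eq_bigr => u uw; congr fglift; apply: graft_rec_irr => //.
by rewrite /fvert (big_rem u) //= leq_addr.
Qed.

Lemma big_msetD (V : nmodType) (F : tree d -> V) v w :
  \sum_(u <- v `+` w) F u = \sum_(u <- v) F u + \sum_(u <- w) F u.
Proof.
rewrite -big_cat /=; apply: perm_big; apply/allP => t _ /=.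
by rewrite count_cat !count_mem_mset msetE2.
Qed.

Lemma big_mset1 (V : nmodType) (F : tree d -> V) u :
  \sum_(t <- [mset u]) F t = F u.
Proof. by rewrite enum_msetn big_seq1. Qed.

Lemma graft_forest0 s : graft_forest s mset0 = 0.
Proof. by rewrite /graft_forest enum_mset0 big_nil. Qed.

Lemma msetD1_sub b u w : u \in w -> (b +` w) `\ u = b +` (w `\ u).
Proof.
move=> uw; apply/msetP => x; rewrite !msetE2 !msetnE.
have: (0 < w u)%N by rewrite -in_mset.
by case: (eqVneq x u) => [->|]; case: eqP => _ w0 //=; rewrite ?subn0 ?addnBA //.
Qed.

Lemma graft_forestD s b w :
  graft_forest s (b +` w) =
    fglift (fun b' => << b' +` w >>) (graft s b) +
    fglift (fun v => << b +` v >>) (graft_forest s w).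
Proof.
rewrite {1}/graft_forest big_msetD big_mset1 msetD1K; congr (_ + _).
rewrite /graft_forest fglift_sum big_seq [RHS]big_seq.
apply: eq_bigr => u uw; rewrite fglift_comp; apply: eq_fglift => u'.
by rewrite fglift1 (msetD1_sub b uw) (msetDCA [mset u'] [mset b] (w `\ u)).
Qed.

Lemma forest_ind (P : forest d -> Prop) :
  P mset0 -> (forall t w, P w -> P (t +` w)) -> forall w, P w.
Proof.
move=> P0 PD w; rewrite -[w]seq_mset_id; elim: (enum_mset w) => [|t r IH].
  by rewrite (_ : seq_mset _ = mset0) //; apply/msetP => x; rewrite mset_seqE mset0E.
rewrite (_ : seq_mset _ = t +` seq_mset r); first exact: PD.
by apply/msetP => x; rewrite mset1DE !mset_seqE /= eq_sym.
Qed.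

Fixpoint fgraft_rec (n : nat) w t : {freeg (tree d) / R} :=
  if n is n'.+1 then
    if enum_mset w is s :: _ then
      let v := w `\ s in
      fglift (graft s) (fgraft_rec n' v t)
      - fglift (fun v' => fgraft_rec n' v' t) (graft_forest s v)
    else << t >>
  else << t >>.

(* The recursion splits off the first tree of the enumeration of w; [fgraftD]
   shows that every choice of tree gives the same result. *)
Definition fgraft w t : {freeg (tree d) / R} := fgraft_rec (size w) w t.



Local Opaque graft graft_forest.

Definition graft_assoc a b x : {freeg (tree d) / R} :=
  fglift (graft a) (graft b x) - fglift (graft^~ x) (graft a b).
Definition forest_assoc a b w : {freeg (forest d) / R} :=
  fglift (graft_forest a) (graft_forest b w)
   - fglift (graft_forest^~ w) (graft a b).
Definition consL w : {freeg (tree d) / R} -> {freeg (forest d) / R} :=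
  fglift (fun u => << u +` w >>).
Definition consR u : {freeg (forest d) / R} -> {freeg (forest d) / R} :=
  fglift (fun w => << u +` w >>).

Lemma graft_forestD' s b w :
  graft_forest s (b +` w) = consL w (graft s b) + consR b (graft_forest s w).
Proof. exact: graft_forestD. Qed.

Lemma forest_assoc_sym a b w :
  (forall u, u \in w -> graft_assoc a b u = graft_assoc b a u) ->
  forest_assoc a b w = forest_assoc b a w.
Proof.
elim/forest_ind: w => [|c w IH] sym_w.
  suff E e f : forest_assoc e f mset0 = 0 by rewrite !E.
  rewrite /forest_assoc graft_forest0 fglift0 fglift_dom big1 ?subr0 // => k _.
  by rewrite graft_forest0 scaler0.
pose cross e f : {freeg (forest d) / R} :=
  fglift (fun c' => consR c' (graft_forest e w)) (graft f c).
have E1 e f : fglift (graft_forest e) (graft_forest f (c +` w)) =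
    (consL w (fglift (graft e) (graft f c)) + cross e f)
    + (cross f e + consR c (fglift (graft_forest e) (graft_forest f w))).
  rewrite graft_forestD' fgliftD; congr (_ + _).
    rewrite /consL !fglift_comp -fglift_addf; apply: eq_fglift => k.
    by rewrite fglift1 graft_forestD'.
  rewrite /cross /consR fglift_swap !fglift_comp -fglift_addf.
  by apply: eq_fglift => k; rewrite fglift1 graft_forestD'.
have E2 e f : fglift (graft_forest^~ (c +` w)) (graft e f) =
    consL w (fglift (graft^~ c) (graft e f))
    + consR c (fglift (graft_forest^~ w) (graft e f)).
  rewrite /consL /consR !fglift_comp -fglift_addf.
  by apply: eq_fglift => k; rewrite graft_forestD'.
have E e f : forest_assoc e f (c +` w) =
    (consL w (graft_assoc e f c) + consR c (forest_assoc e f w)) + (cross e f + cross f e).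
  rewrite /forest_assoc E1 E2 /graft_assoc /consL /consR !fgliftB opprD.
  rewrite -/(consL w) -/(consR c).
  by rewrite (AC ((2*2)*2) ((1*5)*(4*6)*(2*3))).
rewrite !E IH; last by move=> u uw; apply: sym_w; rewrite in_mset1D uw orbT.
by rewrite sym_w ?mset1D1 // [cross a b + _]addrC.
Qed.


Lemma graft_assoc_sym a b t : graft_assoc a b t = graft_assoc b a t.
Proof.
elim/(@tree_ind d): t => i w /forest_assoc_sym symw.
have E1 e f : fglift (graft e) (graft f (node i w)) =
    node_lin i (<< e +` (f +` w) >> + consL w (graft e f)
      + consR f (graft_forest e w) + consR e (graft_forest f w)
      + fglift (graft_forest e) (graft_forest f w)).
  have H y : fglift (graft e) (node_lin i y) =
      node_lin i (consR e y + fglift (graft_forest e) y).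
    rewrite /node_lin /consR -fglift_addf !fglift_comp; apply: eq_fglift => v.
    by rewrite fglift1 graft_node.
  rewrite graft_node H; congr (node_lin i _).
  have -> : consR e (<< f +` w >> + graft_forest f w) =
      << e +` (f +` w) >> + consR e (graft_forest f w).
    by rewrite /consR fgliftD fglift1.
  rewrite fgliftD fglift1 graft_forestD' !addrA.
  by rewrite [LHS](ACl (1*3*4*2*5)).
have E2 e f : fglift (graft^~ (node i w)) (graft e f) =
    node_lin i (consL w (graft e f) + fglift (graft_forest^~ w) (graft e f)).
  rewrite /consL /node_lin -fglift_addf !fglift_comp; apply: eq_fglift => u.
  by rewrite graft_node.
have E e f : graft_assoc e f (node i w) = node_lin i (<< e +` (f +` w) >>
    + (consR f (graft_forest e w) + consR e (graft_forest f w)) + forest_assoc e f w).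
  rewrite /graft_assoc E1 E2 /node_lin -fgliftB -/(node_lin i); congr (node_lin i _).
  rewrite /forest_assoc; set A := consL _ _; rewrite opprD !addrA.
  by rewrite [LHS](ACl (1*3*4*5*7*(2*6))) /= subrr addr0.
by rewrite !E symw msetDCA [consR b _ + _]addrC.
Qed.

Local Opaque fglift.

Lemma size_mset_cons t w : size (t +` w) = (size w).+1.
Proof. by rewrite -!sum1_size big_msetD enum_msetn big_seq1. Qed.

Lemma eq_fglift_forest (V : lmodType R) (f g : forest d -> V) s w :
  (forall v, size v = size w -> f v = g v) ->
  fglift f (graft_forest s w) = fglift g (graft_forest s w).
Proof.
Local Transparent graft_forest.
move=> fg.
rewrite /graft_forest !fglift_sum big_seq [RHS]big_seq; apply: eq_bigr => u uw.
rewrite !fglift_comp; apply: eq_fglift => u'; rewrite !fglift1; apply: fg.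
by rewrite size_mset_cons -(size_mset_cons u) msetB1K.
Qed.

Lemma fgraft0 t : fgraft mset0 t = << t >>.
Proof. by rewrite /fgraft enum_mset0. Qed.

Lemma fgraftD s w t :
  fgraft (s +` w) t =
    fglift (graft s) (fgraft w t) - fglift (fgraft^~ t) (graft_forest s w).
Proof.
Local Opaque graft_forest.
pose D a v := fglift (graft a) (fgraft v t) - fglift (fgraft^~ t) (graft_forest a v).
rewrite -/(D s w); have [k] := ubnP (size w); elim: k s w => // k IH a w ltw.
have [h [v [-> Dw]]] : exists h v, fgraft (a +` w) t = D h v /\ a +` w = h +` v.
  rewrite /fgraft size_mset_cons /=; case E : (enum_mset (a +` w)) => [|h r].
    by move: (size_mset_cons a w); rewrite E.
  have hw : h \in a +` w by have: h \in enum_mset (a +` w) by rewrite E mem_head.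
  exists h, ((a +` w) `\ h); split; last by rewrite msetB1K.
  have sz : size ((a +` w) `\ h) = size w.
    by apply: succn_inj; rewrite -(size_mset_cons h) -(size_mset_cons a) msetB1K.
  rewrite /D {1}/fgraft sz; congr (_ - _).
  by apply: eq_fglift_forest => v'; rewrite sz => <-.
have [eq_ha | ne_ha] := eqVneq h a.
  have <- : w = v by rewrite -(msetD1K a w) -[in RHS](msetD1K h v) -Dw eq_ha.
  by rewrite eq_ha.
have hw : h \in w by move: (mset1D1 h v); rewrite -Dw in_mset1D (negPf ne_ha).
pose u := w `\ h; have Ew : w = h +` u by rewrite msetB1K.
have Ev : v = a +` u.
  by rewrite -(msetD1K h v) -Dw Ew msetDCA msetD1K.
have ltu : (size u < k)%N by move: ltw; rewrite Ew size_mset_cons.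
rewrite Ev Ew; move: (u) ltu => {Dw Ev Ew u hw ltw v w}u ltu.
pose X := fgraft u t; pose G := fgraft^~ t.
pose cr e f := fglift (graft e) (fglift G (graft_forest f u)).
pose S e f := fglift (graft_forest^~ u) (graft e f)
              + fglift (graft_forest f) (graft_forest e u).
have SC e f : S e f = S f e.
  have /eqP := forest_assoc_sym (fun x _ => graft_assoc_sym e f x) (w := u).
  rewrite /forest_assoc subr_eq => /eqP E; rewrite /S E addrA subrKC.
  by rewrite addrC.
have E e f : D e (f +` u) = fglift (graft_assoc e f) X - (cr e f + cr f e) + fglift G (S e f).
  rewrite {1}/D IH // graft_forestD' fgliftD.
  have -> : fglift G (consL u (graft e f)) =
      fglift (fun e' => fglift (graft e') X) (graft e f)
      - fglift G (fglift (graft_forest^~ u) (graft e f)).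
    rewrite /consL !fglift_comp -fglift_subf; apply: eq_fglift => e'.
    by rewrite fglift1 /G IH.
  have -> : fglift G (consR f (graft_forest e u)) =
      cr f e - fglift G (fglift (graft_forest f) (graft_forest e u)).
    rewrite /consR /cr !fglift_comp -fglift_subf.
    by apply: eq_fglift_forest => v sz; rewrite fglift1 /G IH // sz.
  rewrite fglift_subf -fglift_comp -fglift_swap /D -/X -/G fgliftB -/(cr e f) /S fgliftD.
  rewrite !opprD !opprK !addrA.
  by rewrite [LHS](ACl (1*3*2*5*4*6)).
rewrite !E SC [cr h a + _]addrC; congr (_ - _ + _).
by apply: eq_fglift => x; apply: graft_assoc_sym.
Qed.

End Grafting.

Section Finiteness.
Context {d : nat}.

Lemma bounded_seqs (T : eqType) (s : seq T) (k : nat) :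
  exists L : seq (seq T),
    forall l, (size l <= k)%N -> {subset l <= s} -> l \in L.
Proof.
elim: k => [|k [L LP]].
  by exists [:: [::]] => -[|x l].
exists ([::] :: [seq x :: l | x <- s, l <- L]) => -[|x l] //= ltl sub.
rewrite inE; apply/orP; right; apply: allpairs_f; first by apply: sub; rewrite mem_head.
by apply: LP => // y yl; apply: sub; rewrite inE yl orbT.
Qed.

Lemma planar_size_child (c : planar d) cs :
  c \in cs -> (planar_size c <= sumn (map planar_size cs))%N.
Proof.
by move=> ccs; rewrite sumnE big_map (big_rem c) //= leq_addr.
Qed.

Lemma planar_size_gt0 (t : planar d) : (0 < planar_size t)%N.
Proof. by case: t. Qed.

Lemma bounded_planars m : exists s : seq (planar d),
  forall t, (planar_size t <= m)%N -> t \in s.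
Proof.
elim: m => [|m [s sP]]; first by exists [::] => -[].
have [L LP] := bounded_seqs s m.
exists [seq PNode i cs | i <- enum 'I_d, cs <- L] => -[i cs] /=; rewrite ltnS => le_cs.
apply: allpairs_f; first by rewrite mem_enum.
apply: LP => [|c ccs]; last exact/sP/(leq_trans (planar_size_child ccs)).
apply: leq_trans le_cs; rewrite sumnE big_map -sum1_size.
by apply: leq_sum => c _; apply: planar_size_gt0.
Qed.

Lemma bounded_trees m : exists s : seq (tree d),
  forall t, (nvert t <= m)%N -> t \in s.
Proof.
have [s sP] := bounded_planars m; exists (pmap insub s) => t lt_t.
by rewrite mem_pmap_sub; apply: sP.
Qed.

Definition trees_upto (m : nat) : set (tree d) :=
  [set t | (nvert t <= m)%N]%classic.

Definition forests_upto (m : nat) : set (forest d) :=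
  [set w | (fvert w <= m)%N]%classic.

Lemma finite_trees_upto m : finite_set (trees_upto m).
Proof.
have [s sP] := bounded_trees m.
by apply: (sub_finite_set (B := [set` s]%classic)) => //= t; apply: sP.
Qed.

Lemma finite_forests_upto m : finite_set (forests_upto m).
Proof.
have [s sP] := bounded_trees m; have [L LP] := bounded_seqs s m.
apply: (sub_finite_set (B := [set` map seq_mset L]%classic)) => //= w lt_w.
rewrite -(seq_mset_id w); apply: map_f; apply: LP => [|t tw].
  apply: leq_trans lt_w; rewrite /fvert -sum1_size.
  by apply: leq_sum => t _; apply: planar_size_gt0.
apply: sP; apply: leq_trans lt_w.
by rewrite /fvert (big_rem t) //= leq_addr.
Qed.

End Finiteness.

Section ElementaryDifferentials.
Context {R : realType} {n : nat}.
Implicit Types (f : 'rV[R]_n -> 'rV[R]_n) (x z : 'rV[R]_n).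

Definition partial (i : 'I_n) f : 'rV[R]_n -> 'rV[R]_n :=
  fun x => 'D_(delta_mx 0 i) f x.

Definition partials (I : seq 'I_n) f : 'rV[R]_n -> 'rV[R]_n := foldr partial f I.

Definition smooth f : Prop :=
  forall I : seq 'I_n,
    continuous (partials I f) /\
    forall i x, derivable (partials I f) x (delta_mx 0 i).

(* [nabla f x [:: v_1; ...; v_k]] is the k-th derivative of f at x, contracted
   with v_1, ..., v_k. *)
Definition nabla f x (vs : seq 'rV[R]_n) : 'rV[R]_n :=
  \sum_(I : (size vs).-tuple 'I_n)
    (\prod_(l < size vs) vs`_l 0 (tnth I l)) *: partials I f x.

Context {d : nat}.
Variable sigma : 'I_d -> 'rV[R]_n -> 'rV[R]_n.

Fixpoint elem_diff_rec (k : nat) (t : tree d) x : 'rV[R]_n :=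
  if k is k'.+1 then
    nabla (sigma (troot t)) x [seq elem_diff_rec k' u x | u <- children t]
  else 0.

(* The vertex count bounds the recursion depth; see [elem_diff_node]. *)
Definition elem_diff (t : tree d) : 'rV[R]_n -> 'rV[R]_n :=
  elem_diff_rec (nvert t) t.

Lemma elem_diff_rec_irr k l t x : (nvert t <= k)%N -> (nvert t <= l)%N ->
  elem_diff_rec k t x = elem_diff_rec l t x.
Proof.
elim: k l t => [l t|k IH [|l] t]; first by rewrite leqNgt nvert_gt0.
  by rewrite [(nvert t <= 0)%N]leqNgt nvert_gt0.
move=> ltk ltl /=; congr nabla; apply/eq_in_map => u /nvert_child ltu.
by apply: IH; rewrite -ltnS; apply: leq_trans ltu _.
Qed.

Lemma elem_diff_node i (w : forest d) x :
  elem_diff (node i w) x = nabla (sigma i) x [seq elem_diff u x | u <- w].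
Proof.
rewrite {1}/elem_diff nvert_node /= troot_node children_node.
congr nabla; apply/eq_in_map => u uw; apply: elem_diff_rec_irr => //.
by rewrite /fvert (big_rem u) //= leq_addr.
Qed.

Definition elem_diff_lin (A : {freeg (tree d) / R}) x : 'rV[R]_n :=
  fglift (elem_diff^~ x) A.

End ElementaryDifferentials.

Section Statement.
Context {R : realType} {n d : nat}.
Implicit Types (w : forest d).

Definition forest_sym w : nat := (\prod_(t <- finsupp w) (w t)`!)%N.

(* Functionals on the forests with at most m vertices are given by total
   functions, whose values on larger forests are left unconstrained. *)
Definition multiplicative_upto (m : nat) (X : forest d -> R) : Prop :=
  X mset0 = 1 /\
  forall w1 w2, (fvert (w1 `+` w2) <= m)%N -> X (w1 `+` w2) = X w1 * X w2.

(* z^[j], for 1 <= j. *)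
Definition zbracket (sigma : 'I_d -> 'rV[R]_n -> 'rV[R]_n) (z1 z2 : 'rV[R]_n)
    (X : forest d -> R) (j : nat) : 'rV[R]_n :=
  z2 - z1 -
  \sum_(t \in trees_upto j.-1) X [mset t] *: elem_diff sigma t z1.

(* The factors of the tensor product [Upsilon X]^w. *)
Definition elem_diff_weights (sigma : 'I_d -> 'rV[R]_n -> 'rV[R]_n)
    (z1 : 'rV[R]_n) (X : forest d -> R) (w : forest d) : seq 'rV[R]_n :=
  [seq X [mset t] *: elem_diff sigma t z1 | t <- w].

(* Componentwise integral over [0, 1]. *)
Definition integral01 (f : R -> 'rV[R]_n) : 'rV[R]_n :=
  \row_i (\int[lebesgue_measure]_(r in `[0%R, 1%R]) f r 0 i).

End Statement.

(* Main.v *)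
(** For smooth f the k-th derivative contracted with constant vectors is an
    iterated directional derivative, symmetric in the vectors by Schwarz, and
    differentiating it along v at vectors that vary with the point adds a slot v
    plus one term per slot in which that slot is differentiated.  Hence, by
    induction, grafting acts as the directional derivative,
    Upsilon_{s grafted on t} = D_{Upsilon_s} Upsilon_t, and the Guin-Oudom recursion
    subtracts exactly the terms with a differentiated slot, so that
    Upsilon_{w grafted on t} = nabla^{|w|} Upsilon_t . Upsilon_w.
    With a_u := X(u) Upsilon_u(z1), the theorem is then the fundamental theorem of
    calculus on [0,1] for
      G(r) = sum_w (1-r)^(#w) / pi(w) nabla^(#w) Upsilon_tau(z1 + r(z2 - z1)) . a_w.
    In G', writing z2 - z1 as z^[m+1-|w|] plus the sum of a_t over trees t with
    |t| + |w| <= m, the terms carrying an extra a_t cancel against those coming from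
    the derivative of (1-r)^(#w), because v = t w gives 1/pi(w) = v(t)/pi(v) and
    sum_t v(t) = #v. *)
Require Import Defs.
From HB Require Import structures.
From mathcomp Require Import all_boot all_order all_algebra.
From mathcomp Require Import all_classical all_reals all_analysis.
From mathcomp Require Import finmap multiset freeg.
Set Implicit Arguments.
Unset Strict Implicit.
Unset Printing Implicit Defensive.
Import Order.TTheory GRing.Theory Num.Theory.
Import numFieldNormedType.Exports.
Local Open Scope ring_scope.
Local Open Scope mset_scope.

(** * Directional derivatives and Schwarz's theorem *)

Section DirectionalDerivatives.
Context {R : realType} {V : normedModType R}.
Implicit Types (f g : V -> R) (u v w x y : V).
Local Open Scope classical_set_scope.

(** The difference quotient of the restriction to the line is literally that of [f] at [t *: u + x]
    along [u]; this opens directional derivatives to one-variable calculus. *)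
Lemma is_derive_line f u x (t : R) :
  derivable f (t *: u + x) u ->
  is_derive t 1 (fun s : R => f (s *: u + x)) ('D_u f (t *: u + x)).
Proof.
rewrite /derivable /derive => df.
have E : (fun h : R => h^-1 *:
      (((fun s => f (s *: u + x)) \o shift t) (h *: 1) - f (t *: u + x)))
  = (fun h : R => h^-1 *: ((f \o shift (t *: u + x)) (h *: u) - f (t *: u + x))).
  by apply/funext => h /=; rewrite [h *: 1]mulr1 scalerDl addrA.
by apply: DeriveDef; rewrite /derivable /derive E.
Qed.

(** Mean value theorem on the segment between [0] and [s]. The bound [|c| <= |s|] covers both signs
    of [s] and is what the limit arguments consume. *)
Lemma MVT_line f u x (s : R) : (forall y, derivable f y u) ->
  exists2 c : R, `|c| <= `|s| & f (s *: u + x) - f x = s * 'D_u f (c *: u + x).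
Proof.
move=> df.
have dF (t : R) : is_derive t 1 (fun s : R => f (s *: u + x)) ('D_u f (t *: u + x)).
  exact: is_derive_line.
have cF a b : {within `[a, b], continuous (fun s : R => f (s *: u + x))}%classic.
  apply: continuous_subspaceT => t.
  by apply/differentiable_continuous/derivable1_diffP; case: (dF t).
have [s0|s0] := leP 0 s.
  have [c] := MVT_segment s0 (fun t _ => dF t) (cF _ _).
  rewrite in_itv/= => /andP[c0 cs]; rewrite scale0r add0r subr0 => ->.
  by exists c; [rewrite !ger0_norm|rewrite mulrC].
have [c] := MVT_segment (ltW s0) (fun t _ => dF t) (cF _ _).
rewrite in_itv/= => /andP[cs c0]; rewrite scale0r add0r sub0r => E.
exists c; first by rewrite !ler0_norm ?lerN2 // ltW.
by rewrite -opprB E mulrN opprK mulrC.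
Qed.

(** Serves for the intermediate points of the mean value theorem, whose dependence on [h] is known
    only through a bound. *)
Lemma cvg_shrink (c : R -> R) (k : R) u x (y : R -> V) :
  (forall h, `|c h| <= `|h * k|) -> (y @ 0^' --> x)%classic ->
  ((fun h => c h *: u + y h) @ 0^' --> x)%classic.
Proof.
move=> ch yx; rewrite -[x]add0r -(scale0r u); apply: cvgD => //.
apply: cvgZ; last exact: cvg_cst.
apply: norm_cvg0; apply: (@squeeze_cvgr _ _ _ _ (cst 0) (fun h => `|h * k|)).
- by near=> h; rewrite normr_ge0 ch.
- exact: cvg_cst.
- have : (fun h : R => `|h * k|) @ 0^' --> `|0 * k|.
    by apply: cvg_norm; apply: cvgM; [exact: nbhs_dnbhs | exact: cvg_cst].
  by rewrite mul0r normr0.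
Unshelve. all: by end_near. Qed.

(** The increment [h *: (a *: u + w)] is made in two moves: first along [w], where derivability at
    [x] suffices, then along [u], where the mean value theorem and continuity of ['D_u f] at [x]
    give the limit. *)
Lemma is_derive_linear f u w x (a : R) :
  (forall y, derivable f y u) -> {for x, continuous ('D_u f)} ->
  derivable f x w ->
  is_derive x (a *: u + w) f (a * 'D_u f x + 'D_w f x).
Proof.
move=> dfu cfu dfw.
have /choice [c cP] : forall h, exists c : R, `|c| <= `|h * a| /\
    f ((h * a) *: u + (h *: w + x)) - f (h *: w + x)
      = h * a * 'D_u f (c *: u + (h *: w + x)).
  move=> h; have [c ? ?] := MVT_line (h *: w + x) (h * a) dfu.
  by exists c.
suff L : ((fun h => h^-1 *: ((f \o shift x) (h *: (a *: u + w)) - f x)) @ 0^'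
  --> a * 'D_u f x + 'D_w f x)%classic.
  by apply: DeriveDef; [apply/cvg_ex; eexists; exact: L | exact: cvg_lim L].
have Lw : (fun h : R => h *: w + x) @ 0^' --> x.
  have : (fun h : R => h *: w + x) @ 0^' --> 0 *: w + x.
    by apply: cvgD; last exact: cvg_cst; apply: cvgZ; [exact: nbhs_dnbhs | exact: cvg_cst].
  by rewrite scale0r add0r.
have Lc : (fun h => 'D_u f (c h *: u + (h *: w + x))) @ 0^' --> 'D_u f x.
  exact: cvg_comp (cvg_shrink u (fun h => (cP h).1) Lw) cfu.
have L : (fun h => a * 'D_u f (c h *: u + (h *: w + x))
    + h^-1 *: ((f \o shift x) (h *: w) - f x)) @ 0^' --> a * 'D_u f x + 'D_w f x.
  by apply: cvgD; [apply: cvgM; [exact: cvg_cst | exact: Lc] | exact: dfw].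
apply: cvg_trans L; apply: (near_eq_cvg (F := 0^')); near=> h.
have h0 : h != 0 by near: h; exact: nbhs_dnbhs_neq.
rewrite /= [h *: (_ + _)]scalerDr scalerA -[_ + _ + x]addrA.
rewrite -[f (_ *: u + _) in RHS](subrK (f (h *: w + x))) (cP h).2 -[in RHS]addrA [in RHS]scalerDr.
by congr (_ + _); rewrite -mulrA; exact/esym/(mulKf h0).
Unshelve. all: by end_near. Qed.

(** Mean value theorem twice: along [u] for [y |-> f (h *: w + y) - f y], then along [w] for
    ['D_u f]. *)
Lemma second_difference f u w x (h : R) :
  (forall y, derivable f y u) -> (forall y, derivable ('D_u f) y w) ->
  exists a b : R, [/\ `|a| <= `|h|, `|b| <= `|h| &
    f (h *: u + (h *: w + x)) - f (h *: u + x) - (f (h *: w + x) - f x)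
    = h * (h * 'D_w ('D_u f) (b *: w + (a *: u + x)))].
Proof.
move=> dfu dfuw.
have dg y : is_derive y u (fun y => f (h *: w + y) - f y) ('D_u f (h *: w + y) - 'D_u f y).
  apply: is_deriveB; last exact: derivableP.
  have := derivableP (dfu (h *: w + y)).
  rewrite /= => -[]; rewrite /derivable /derive => d1 d2.
  have E : (fun t : R => t^-1 *: (((fun y => f (h *: w + y)) \o shift y) (t *: u) - f (h *: w + y)))
   = (fun t : R => t^-1 *: ((f \o shift (h *: w + y)) (t *: u) - f (h *: w + y))).
    by apply/funext => t /=; rewrite addrCA.
  by apply: DeriveDef; rewrite /derivable /derive E.
have [a ah] := @MVT_line _ u x h (fun y => @ex_derive _ _ _ _ _ _ _ (dg y)).
rewrite derive_val.
have [b bh ->] := MVT_line (a *: u + x) h dfuw => E.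
exists a, b; split => //; rewrite -E; congr (_ - _).
by rewrite addrCA.
Qed.

(* Both mixed derivatives are limits of the same second difference quotient. *)
Lemma derive_comm f u w x :
  (forall y, derivable f y u) -> (forall y, derivable f y w) ->
  (forall y, derivable ('D_u f) y w) -> (forall y, derivable ('D_w f) y u) ->
  {for x, continuous ('D_w ('D_u f))} -> {for x, continuous ('D_u ('D_w f))} ->
  'D_w ('D_u f) x = 'D_u ('D_w f) x.
Proof.
move=> dfu dfw dfuw dfwu cuw cwu.
have cvg_pt v1 v2 (a b : R -> R) : (forall h, `|a h| <= `|h|) -> (forall h, `|b h| <= `|h|) ->
    ((fun h => b h *: v2 + (a h *: v1 + x)) @ 0^' --> x)%classic.
  move=> ah bh; apply: (@cvg_shrink _ 1) => [h|]; first by rewrite mulr1.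
  apply: (@cvg_shrink _ 1) => [h|]; first by rewrite mulr1.
  exact: cvg_cst.
have /choice [p pP] : forall h, exists p : R * R, `|p.1| <= `|h| /\ `|p.2| <= `|h| /\
    f (h *: u + (h *: w + x)) - f (h *: u + x) - (f (h *: w + x) - f x)
    = h * (h * 'D_w ('D_u f) (p.2 *: w + (p.1 *: u + x))).
  by move=> h; have [a [b []]] := second_difference x h dfu dfuw; exists (a, b).
have /choice [q qP] : forall h, exists q : R * R, `|q.1| <= `|h| /\ `|q.2| <= `|h| /\
    f (h *: w + (h *: u + x)) - f (h *: w + x) - (f (h *: u + x) - f x)
    = h * (h * 'D_u ('D_w f) (q.2 *: u + (q.1 *: w + x))).
  by move=> h; have [a [b []]] := second_difference x h dfw dfwu; exists (a, b).
have Lp : (fun h => 'D_w ('D_u f) ((p h).2 *: w + ((p h).1 *: u + x))) @ 0^'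
    --> 'D_w ('D_u f) x.
  exact: cvg_comp (cvg_pt u w _ _ (fun h => (pP h).1) (fun h => (pP h).2.1)) cuw.
have Lq : (fun h => 'D_u ('D_w f) ((q h).2 *: u + ((q h).1 *: w + x))) @ 0^'
    --> 'D_u ('D_w f) x.
  exact: cvg_comp (cvg_pt w u _ _ (fun h => (qP h).1) (fun h => (qP h).2.1)) cwu.
have E (h : R) : h != 0 ->
    'D_u ('D_w f) ((q h).2 *: u + ((q h).1 *: w + x)) =
    'D_w ('D_u f) ((p h).2 *: w + ((p h).1 *: u + x)).
  move=> h0; have [_ [_ Ep]] := pP h; have [_ [_ Eq]] := qP h.
  (* Exchanging [u] and [w] only swaps the two middle terms of the second difference, so both mean
     value forms equal the same number; the factor [h] then cancels twice. *)
  have subACA (a b c e : R) : a - b - (c - e) = a - c - (b - e).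
    by rewrite !opprB [LHS]addrACA [RHS]addrACA [- b + _]addrC.
  apply: (mulfI h0); apply: (mulfI h0); apply: etrans (esym Eq) (etrans _ Ep).
  by rewrite subACA [h *: u + (_ + _)]addrCA.
apply: (cvg_unique (@norm_hausdorff _ _) Lp); apply: cvg_trans Lq.
apply: (near_eq_cvg (F := 0^')); near=> h; apply: E; near: h; exact: nbhs_dnbhs_neq.
Unshelve. all: by end_near. Qed.

End DirectionalDerivatives.

(** * Smooth functions *)

Section SmoothScalar.
Context {R : realType} {n : nat}.
Implicit Types (f g : 'rV[R]_n -> R) (u v w x y : 'rV[R]_n).
Local Notation e_ i := (delta_mx 0 i : 'rV[R]_n).

(** The class C^k by recursion on the order, through coordinate partial derivatives, so that closure
    under sums and products goes by induction on [k]. *)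
Fixpoint Cdiff (k : nat) f : Prop :=
  continuous f /\
  if k is k'.+1 then
    forall i, (forall x, derivable f x (e_ i)) /\ Cdiff k' ('D_(e_ i) f)
  else True.

Definition smooth1 f : Prop := forall k, Cdiff k f.

Lemma CdiffW k f : Cdiff k.+1 f -> Cdiff k f.
Proof.
elim: k f => [|k IH] f [cf df]; split=> // i.
by have [dfi /IH] := df i.
Qed.

Lemma smooth1_continuous f : smooth1 f -> continuous f.
Proof. by move=> /(_ 0) []. Qed.

Lemma smooth1_derive_basis i f : smooth1 f -> smooth1 ('D_(e_ i) f).
Proof. by move=> sf k; have [_ /(_ i) []] := sf k.+1. Qed.

Lemma smooth1_derivable_basis i f x : smooth1 f -> derivable f x (e_ i).
Proof. by move=> /(_ 1) [_ /(_ i) []]. Qed.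

Lemma Cdiff_cst k (c : R) : Cdiff k (fun=> c).
Proof.
elim: k c => [|k IH] c; split=> //; try exact: cst_continuous.
move=> i; split=> [x|]; first exact: derivable_cst.
rewrite (_ : 'D_(e_ i) _ = fun=> 0) //.
by apply/funext => x; exact: derive_cst.
Qed.

Lemma CdiffD k f g : Cdiff k f -> Cdiff k g -> Cdiff k (fun x => f x + g x).
Proof.
elim: k f g => [|k IH] f g [cf df] [cg dg]; split=> //.
- by move=> x; exact: (cvgD (cf x) (cg x)).
- by move=> x; exact: (cvgD (cf x) (cg x)).
move=> i; have [dfi sf] := df i; have [dgi sg] := dg i.
split=> [x|]; first exact: derivableD.
rewrite (_ : 'D_(e_ i) _ = fun x => 'D_(e_ i) f x + 'D_(e_ i) g x).
  exact: IH.
by apply/funext => x; exact: deriveD.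
Qed.

Lemma CdiffM k f g : Cdiff k f -> Cdiff k g -> Cdiff k (fun x => f x * g x).
Proof.
elim: k f g => [|k IH] f g.
  move=> [cf _] [cg _]; split=> // x.
  exact: (cvgM (cf x) (cg x)).
(* The product rule multiplies a derivative of order [k] by an undifferentiated factor, which must
   therefore be weakened to order [k] as well. *)
move=> Cf Cg; have [Cf' Cg'] := (CdiffW Cf, CdiffW Cg).
move: Cf Cg => [cf df] [cg dg]; split=> [x|i].
  exact: (cvgM (cf x) (cg x)).
have [dfi sf] := df i; have [dgi sg] := dg i.
split=> [x|]; first exact: derivableM.
rewrite (_ : 'D_(e_ i) _ = fun x => f x * 'D_(e_ i) g x + g x * 'D_(e_ i) f x).
  by apply: CdiffD; apply: IH.
by apply/funext => x; exact: deriveM.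
Qed.

Lemma smooth1_cst (c : R) : smooth1 (fun=> c).
Proof. by move=> k; exact: Cdiff_cst. Qed.

Lemma smooth1D f g : smooth1 f -> smooth1 g -> smooth1 (fun x => f x + g x).
Proof. by move=> sf sg k; exact: CdiffD. Qed.

Lemma smooth1M f g : smooth1 f -> smooth1 g -> smooth1 (fun x => f x * g x).
Proof. by move=> sf sg k; exact: CdiffM. Qed.

Lemma smooth1_sum (I : Type) (r : seq I) (F : I -> 'rV[R]_n -> R) :
  (forall i, smooth1 (F i)) -> smooth1 (fun x => \sum_(i <- r) F i x).
Proof.
move=> sF; elim: r => [|i r IH].
  by under eq_fun do rewrite big_nil; exact: smooth1_cst.
by under eq_fun do rewrite big_cons; exact: smooth1D.
Qed.

(** The direction is built up one basis vector at a time with [is_derive_linear], using that the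
    partial derivatives are continuous. *)
Lemma smooth1_is_derive f x v : smooth1 f ->
  is_derive x v f (\sum_i v 0 i * 'D_(e_ i) f x).
Proof.
move=> sf; rewrite {1}[v]row_sum_delta.
elim: (index_enum _) => [|i r IH]; first by rewrite !big_nil; exact: is_derive0.
rewrite !big_cons; case: IH => dr <-.
apply: is_derive_linear dr; first by move=> y; exact: smooth1_derivable_basis.
exact/smooth1_continuous/smooth1_derive_basis.
Qed.

Lemma smooth1_derivable f x v : smooth1 f -> derivable f x v.
Proof. by move=> /(smooth1_is_derive x v) []. Qed.

Lemma smooth1_deriveE f x v : smooth1 f ->
  'D_v f x = \sum_i v 0 i * 'D_(e_ i) f x.
Proof. by move=> /(smooth1_is_derive x v) []. Qed.

Lemma smooth1_derive v f : smooth1 f -> smooth1 ('D_v f).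
Proof.
move=> sf; rewrite (_ : 'D_v f = fun x => \sum_i v 0 i * 'D_(e_ i) f x).
  apply: smooth1_sum => i; apply: smooth1M; first exact: smooth1_cst.
  exact: smooth1_derive_basis.
by apply/funext => x; exact: smooth1_deriveE.
Qed.

Lemma smooth1_derive_comm f v w : smooth1 f -> 'D_w ('D_v f) = 'D_v ('D_w f).
Proof.
move=> sf; apply/funext => x; apply: derive_comm.
- by move=> y; exact: smooth1_derivable.
- by move=> y; exact: smooth1_derivable.
- by move=> y; apply: smooth1_derivable; exact: smooth1_derive.
- by move=> y; apply: smooth1_derivable; exact: smooth1_derive.
- by apply: smooth1_continuous; do 2 apply: smooth1_derive.
- by apply: smooth1_continuous; do 2 apply: smooth1_derive.
Qed.

Definition iter_derive (vs : seq 'rV[R]_n) f : 'rV[R]_n -> R :=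
  foldr (fun v g => 'D_v g) f vs.

Lemma smooth1_iter_derive vs f : smooth1 f -> smooth1 (iter_derive vs f).
Proof. by move=> sf; elim: vs => //= v vs; exact: smooth1_derive. Qed.

Lemma iter_derive_comm vs v f : smooth1 f ->
  'D_v (iter_derive vs f) = iter_derive vs ('D_v f).
Proof.
move=> sf; elim: vs => //= w vs <-.
by apply: smooth1_derive_comm; exact: smooth1_iter_derive.
Qed.

Lemma iter_derive_perm us vs f : smooth1 f -> perm_eq us vs ->
  iter_derive us f = iter_derive vs f.
Proof.
move=> sf; elim: us vs => [|u us IH] vs E.
  by move: E; rewrite perm_sym => /perm_nilP ->.
have uvs : u \in vs by rewrite -(perm_mem E) mem_head.
have {}E : perm_eq us (rem u vs).
  by rewrite -(perm_cons u); apply: perm_trans E (perm_to_rem uvs).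
rewrite /= (IH _ E).
(* It remains to move [u] from its first occurrence in [vs] to the front, one Schwarz exchange at a
   time. *)
elim: vs uvs {IH E} => //= w vs IH; rewrite inE eq_sym; case: eqVneq => [->//|_] /= /IH <-.
by apply: smooth1_derive_comm; exact: smooth1_iter_derive.
Qed.

End SmoothScalar.

(** * Iterated derivatives along vector fields *)

Section VectorFields.
Context {R : realType} {n : nat}.
Implicit Types (f g : 'rV[R]_n -> R) (F : 'rV[R]_n -> 'rV[R]_n) (u v w x y : 'rV[R]_n).
Local Notation e_ i := (delta_mx 0 i : 'rV[R]_n).

Definition smooth_coords F : Prop := forall j, smooth1 (fun x => F x 0 j).

Lemma smooth_coords_derivable F x v : smooth_coords F -> derivable F x v.
Proof.
by move=> sF; apply/derivable_mxP => i j; rewrite ord1; exact: smooth1_derivable.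
Qed.

Lemma derive_coord F x v j : derivable F x v ->
  ('D_v F x) 0 j = 'D_v (fun y => F y 0 j) x.
Proof. by move=> dF; rewrite derive_mx // mxE. Qed.

Lemma smooth_smooth_coords F : smooth F -> smooth_coords F.
Proof.
(* Generalised from [F] to [partials I F] for every [I], since each differentiation lengthens the
   index list. *)
move=> sF j k; rewrite -[F]/(partials [::] F); elim: k [::] => [|k IH] I.
  split=> // x; have [cF _] := sF I.
  exact: continuous_comp (cF x) (@coord_continuous _ _ _ 0 j _).
have [cF dF] := sF I; split=> [x|i].
  exact: continuous_comp (cF x) (@coord_continuous _ _ _ 0 j _).
split=> [x|]; first by have /derivable_mxP := dF i x; apply.
rewrite (_ : 'D_(e_ i) _ = fun x => partials (i :: I) F x 0 j); first exact: IH.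
by apply/funext => x; rewrite /= /partial derive_coord.
Qed.

Lemma partials_coord F I x j : smooth_coords F ->
  partials I F x 0 j = iter_derive [seq e_ i | i <- I] (fun y => F y 0 j) x.
Proof.
move=> sF; elim: I x j => [|i I IH] x j //=.
have E k : (fun y => partials I F y 0 k) =
    iter_derive [seq e_ i | i <- I] (fun y => F y 0 k).
  by apply/funext => y; exact: IH.
rewrite /partial derive_coord ?E //; apply/smooth_coords_derivable => k.
by rewrite E; exact: smooth1_iter_derive.
Qed.

Lemma iter_derive_cons v vs f x : smooth1 f ->
  iter_derive (v :: vs) f x = \sum_i v 0 i * iter_derive vs ('D_(e_ i) f) x.
Proof.
move=> sf; rewrite -[LHS]/('D_v (iter_derive vs f) x) smooth1_deriveE; last exact: smooth1_iter_derive.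
by apply: eq_bigr => i _; rewrite -iter_derive_comm.
Qed.

(** The sum over index tuples is the multilinear expansion of the iterated derivative in the basis.
    The induction on [vs] lets [f] vary, as each slot replaces [f] by ['D_(e_ i) f]. *)
Lemma nabla_coord F x vs j : smooth_coords F ->
  nabla F x vs 0 j = iter_derive vs (fun y => F y 0 j) x.
Proof.
move=> sF; rewrite /nabla summxE.
under eq_bigr => I _ do rewrite mxE (partials_coord I x j sF).
move: (fun y => F y 0 j) (sF j) => f {F sF j}.
elim: vs f => [|v vs IH] f sf /=.
  rewrite (big_pred1 [tuple]) => [|I]; last exact/esym/eqP/tuple0.
  by rewrite big_ord0 mul1r.
rewrite -[RHS]/(iter_derive (v :: vs) f x) iter_derive_cons //.
under [RHS]eq_bigr => i _ do
  rewrite -(IH _ (smooth1_derive (e_ i) sf)) big_distrr.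
rewrite pair_big.
(* An index tuple for [v :: vs] is a first index together with a tuple for [vs]. *)
rewrite (reindex (fun p : 'I_n * (size vs).-tuple 'I_n => cons_tuple p.1 p.2)); last first.
  exists (fun I => (thead I, behead_tuple I)) => [[i I] _|I _] /=.
    by congr pair; exact: val_inj.
  by apply: val_inj => /=; case/tupleP: I.
apply: eq_bigr => -[i I] _ /=.
rewrite big_ord_recl /= tnth0 -iter_derive_comm // mulrA.
by congr (_ * _ * _); apply: eq_bigr => l _; rewrite tnthS.
Qed.

Local Arguments iter_derive : simpl never.

Lemma iter_derive_addl v w vs f x : smooth1 f ->
  iter_derive ((v + w) :: vs) f x = iter_derive (v :: vs) f x + iter_derive (w :: vs) f x.
Proof.
move=> sf; rewrite !iter_derive_cons // -big_split; apply: eq_bigr => i _ /=.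
by rewrite mxE mulrDl.
Qed.

Lemma iter_derive_scalel a v vs f x : smooth1 f ->
  iter_derive ((a *: v) :: vs) f x = a * iter_derive (v :: vs) f x.
Proof.
move=> sf; rewrite !iter_derive_cons // big_distrr; apply: eq_bigr => i _ /=.
by rewrite mxE mulrA.
Qed.

Lemma iter_derive_suml f x (I : Type) (s : seq I) (v : I -> 'rV[R]_n) vs :
  smooth1 f ->
  iter_derive (\sum_(i <- s) v i :: vs) f x = \sum_(i <- s) iter_derive (v i :: vs) f x.
Proof.
move=> sf; elim: s => [|i s IH]; last by rewrite !big_cons iter_derive_addl // IH.
by rewrite !big_nil -(scale0r (0 : 'rV_n)) iter_derive_scalel // mul0r.
Qed.

Lemma iter_derive_subl f x v w vs : smooth1 f ->
  iter_derive ((v - w) :: vs) f x = iter_derive (v :: vs) f x - iter_derive (w :: vs) f x.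
Proof.
by move=> sf; rewrite -scaleN1r iter_derive_addl // iter_derive_scalel // mulN1r.
Qed.

Lemma iter_derive_scale_all (T : Type) (c : T -> R) (v : T -> 'rV[R]_n) (s : seq T)
    f x : smooth1 f ->
  iter_derive [seq c t *: v t | t <- s] f x =
  (\prod_(t <- s) c t) * iter_derive [seq v t | t <- s] f x.
Proof.
elim: s f => [|t s IH] f sf; first by rewrite big_nil mul1r.
rewrite big_cons iter_derive_scalel // -mulrA; congr (_ * _).
rewrite !iter_derive_cons // mulr_sumr; apply: eq_bigr => i _.
rewrite IH; last exact: smooth1_derive.
exact: mulrCA.
Qed.

(** Expanding the first field in coordinates gives a sum of products of smooth functions, with one
    field fewer and ['D_(e_ i) f] in place of [f]. *)
Lemma smooth1_iter_derive_fields (T : eqType) (H : T -> 'rV[R]_n -> 'rV[R]_n)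
    (ws : seq T) f :
  smooth1 f -> {in ws, forall t, smooth_coords (H t)} ->
  smooth1 (fun x => iter_derive [seq H t x | t <- ws] f x).
Proof.
elim: ws f => [//|t ws IH] f sf sH.
have -> : (fun x => iter_derive [seq H t x | t <- t :: ws] f x) = fun x =>
    \sum_i H t x 0 i * iter_derive [seq H t x | t <- ws] ('D_(e_ i) f) x.
  by apply/funext => x; rewrite -iter_derive_cons.
apply: smooth1_sum => i; apply: smooth1M; first by apply: sH; rewrite mem_head.
apply: IH; first exact: smooth1_derive.
by move=> u uws; apply: sH; rewrite inE uws orbT.
Qed.

(** Leibniz rule, by expanding the first field in coordinates. Differentiating its coefficient gives
    the term of the first slot; the other factor gives, by induction, the new slot [v] and the
    remaining slots. *)
Lemma derive_iter_derive_fields (T : eqType) (H : T -> 'rV[R]_n -> 'rV[R]_n)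
    (ws : seq T) f x v :
  smooth1 f -> {in ws, forall t, smooth_coords (H t)} ->
  'D_v (fun y => iter_derive [seq H t y | t <- ws] f y) x =
    iter_derive (v :: [seq H t x | t <- ws]) f x
    + \sum_(u <- ws) iter_derive ('D_v (H u) x :: [seq H t x | t <- rem u ws]) f x.
Proof.
elim: ws f => [|t ws IH] f sf sH; first by rewrite big_nil addr0.
have sHt : smooth_coords (H t) by apply: sH; rewrite mem_head.
have sHws : {in ws, forall t, smooth_coords (H t)}.
  by move=> u uws; apply: sH; rewrite inE uws orbT.
have sD i : smooth1 ('D_(e_ i) f) by exact: smooth1_derive.
pose G i := (fun y => H t y 0 i) *
  (fun y => iter_derive [seq H t y | t <- ws] ('D_(e_ i) f) y).
have -> : (fun y => iter_derive [seq H t y | t <- t :: ws] f y) = \sum_i G i.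
  by apply/funext => y; rewrite fct_sumE iter_derive_cons.
have dH i : derivable (fun y => H t y 0 i) x v by exact: smooth1_derivable.
have dI i : derivable (fun y => iter_derive [seq H t y | t <- ws] ('D_(e_ i) f) y) x v.
  by apply: smooth1_derivable; exact: smooth1_iter_derive_fields.
rewrite derive_sum => [|i]; last exact: derivableM.
under eq_bigr => i _ do
  rewrite deriveM // IH // -(derive_coord _ (@smooth_coords_derivable (H t) x v sHt)).
rewrite big_split /=.
have -> : \sum_i iter_derive [seq H t x | t <- ws] ('D_(e_ i) f) x *: ('D_v (H t) x) 0 i
   = iter_derive ('D_v (H t) x :: [seq H t x | t <- ws]) f x.
  by rewrite iter_derive_cons //; apply: eq_bigr => i _; exact: mulrC.
under eq_bigr => i _ do rewrite scalerDr scaler_sumr.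
rewrite big_split exchange_big /= big_cons eqxx.
have P : perm_eq [:: v, H t x & [seq H t x | t <- ws]]
    [:: H t x, v & [seq H t x | t <- ws]].
  exact/permEl/(perm_catCA [:: v] [:: H t x]).
rewrite (iter_derive_perm sf P) [iter_derive (H t x :: _) _ _]iter_derive_cons //.
rewrite -[LHS]addrA; congr (_ + _).
rewrite addrC; congr (_ + _); rewrite big_seq [RHS]big_seq; apply: eq_bigr => u uws.
(* The conditional is [rem u (t :: ws)] unfolded. If [t = u], two occurrences compete for removal,
   and either choice leaves the same list up to permutation. *)
have {}P : perm_eq
    ('D_v (H u) x :: [seq H t x | t <- if t == u then ws else t :: rem u ws])
    [:: H t x, 'D_v (H u) x & [seq H t x | t <- rem u ws]].
  rewrite perm_sym.
  apply: (perm_trans (permEl (perm_catCA [:: H t x] [:: 'D_v (H u) x] _))).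
  rewrite /= perm_cons; case: eqVneq => [tu|_] //=.
  rewrite tu perm_sym -[X in perm_eq _ X]/[seq H t x | t <- u :: rem u ws].
  exact/perm_map/perm_to_rem.
by rewrite (iter_derive_perm sf P) [RHS]iter_derive_cons.
Qed.

End VectorFields.

(** * Elementary differentials of grafted trees *)

Section Nabla.
Context {R : realType} {n : nat}.
Implicit Types (F : 'rV[R]_n -> 'rV[R]_n) (u v w x y : 'rV[R]_n).

Lemma nabla_perm F x us vs : smooth_coords F -> perm_eq us vs ->
  nabla F x us = nabla F x vs.
Proof.
move=> sF uv; apply/rowP => j.
by rewrite !nabla_coord // (iter_derive_perm (sF j) uv).
Qed.

Lemma nablaZl F x a v vs : smooth_coords F ->
  nabla F x (a *: v :: vs) = a *: nabla F x (v :: vs).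
Proof.
by move=> sF; apply/rowP => j; rewrite mxE !nabla_coord // iter_derive_scalel.
Qed.

Lemma nabla_suml F x (I : Type) (r : seq I) (G : I -> 'rV[R]_n) vs :
  smooth_coords F ->
  nabla F x (\sum_(i <- r) G i :: vs) = \sum_(i <- r) nabla F x (G i :: vs).
Proof.
move=> sF; apply/rowP => j; rewrite nabla_coord // iter_derive_suml // summxE.
by apply: eq_bigr => i _; rewrite nabla_coord.
Qed.

Lemma nabla_fglift F x (K : choiceType) (g : K -> 'rV[R]_n) (A : {freeg K / R}) vs :
  smooth_coords F ->
  nabla F x (fglift g A :: vs) = fglift (fun k => nabla F x (g k :: vs)) A.
Proof.
move=> sF; rewrite !fglift_dom nabla_suml //.
by apply: eq_bigr => k _; exact: nablaZl.
Qed.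

Lemma derive_nabla_fields (T : eqType) (H : T -> 'rV[R]_n -> 'rV[R]_n) (ws : seq T)
    F x v :
  smooth_coords F -> {in ws, forall t, smooth_coords (H t)} ->
  'D_v (fun y => nabla F y [seq H t y | t <- ws]) x =
    nabla F x (v :: [seq H t x | t <- ws])
    + \sum_(u <- ws) nabla F x ('D_v (H u) x :: [seq H t x | t <- rem u ws]).
Proof.
move=> sF sH; apply/rowP => j; rewrite mxE summxE derive_coord; last first.
  apply: smooth_coords_derivable => k.
  under eq_fun => y do rewrite nabla_coord //.
  exact: smooth1_iter_derive_fields.
under eq_fun => y do rewrite nabla_coord //.
rewrite derive_iter_derive_fields // nabla_coord //; congr (_ + _).
by apply: eq_bigr => u _; rewrite nabla_coord.
Qed.

End Nabla.

Lemma is_derive_sum_seq (R : numFieldType) (V W : normedModType R) (I : Type)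
    (s : seq I) (h : I -> V -> W) (dh : I -> W) x v :
  (forall i, is_derive x v (h i) (dh i)) ->
  is_derive x v (fun y => \sum_(i <- s) h i y) (\sum_(i <- s) dh i).
Proof.
move=> dhi; elim: s => [|i s IH].
  by under eq_fun do rewrite big_nil; rewrite big_nil; exact: is_derive_cst.
by under eq_fun do rewrite big_cons; rewrite big_cons; exact: is_deriveD.
Qed.

Section ElementaryDifferentialsOfGrafts.
Context {R : realType} {n d : nat}.
Variable sigma : 'I_d -> 'rV[R]_n -> 'rV[R]_n.
Hypothesis smooth_sigma : forall j, smooth (sigma j).
Local Notation "'Y'" := (elem_diff sigma).

(** The enumeration of a multiset has no prescribed order, so lists are compared up to permutation,
    to which [nabla] of a smooth field is insensitive. *)
Lemma perm_enum_msetD1 (T : choiceType) (t : T) (w : {mset T}) :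
  perm_eq (t +` w) (t :: w).
Proof.
apply/allP => x _ /=.
by rewrite !count_mem_mset mset1DE (eq_sym x).
Qed.

Lemma perm_enum_msetB1 (T : choiceType) (t : T) (w : {mset T}) :
  t \in w -> perm_eq (rem t w) (w `\ t).
Proof.
move=> tw; have := perm_enum_msetD1 t (w `\ t); rewrite msetB1K // => E.
by rewrite -(perm_cons t) -(permPl (perm_to_rem tw)).
Qed.

Lemma smooth_coords_elem_diff (t : tree d) : smooth_coords (Y t).
Proof.
elim/(@tree_ind d): t => i w IH j.
have sF := smooth_smooth_coords (smooth_sigma i).
under eq_fun => x do rewrite elem_diff_node nabla_coord //.
by apply: smooth1_iter_derive_fields; [exact: sF | exact: IH].
Qed.

Lemma nabla_elem_diff_msetD F x (t : tree d) (w : forest d) : smooth_coords F ->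
  nabla F x [seq Y u x | u <- t +` w] = nabla F x (Y t x :: [seq Y u x | u <- w]).
Proof. by move=> sF; apply: nabla_perm => //; exact/(perm_map _ (perm_enum_msetD1 t w)). Qed.

Lemma derive_nabla_elem_diff F x v (w : forest d) : smooth_coords F ->
  'D_v (fun y => nabla F y [seq Y u y | u <- w]) x =
    nabla F x (v :: [seq Y u x | u <- w])
    + \sum_(u <- w) nabla F x ('D_v (Y u) x :: [seq Y t x | t <- w `\ u]).
Proof.
move=> sF; rewrite derive_nabla_fields //; last by move=> u _; exact: smooth_coords_elem_diff.
congr (_ + _); rewrite big_seq [RHS]big_seq; apply: eq_bigr => u uw.
by apply: nabla_perm => //; rewrite perm_cons; exact/perm_map/perm_enum_msetB1.
Qed.

(** The two sides match term by term: attaching [s] at the root is the added slot of the Leibniz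
    rule, and grafting into a child [u] is the differentiation of the slot [u]. *)
Lemma elem_diff_lin_graft (s t : tree d) x :
  elem_diff_lin sigma (graft s t) x = 'D_(Y s x) (Y t) x.
Proof.
elim/(@tree_ind d): t => i w IH.
have sF : smooth_coords (sigma i) by exact: smooth_smooth_coords.
rewrite (_ : Y (node i w) = fun y => nabla (sigma i) y [seq Y u y | u <- w]); last first.
  by apply/funext => y; rewrite elem_diff_node.
rewrite derive_nabla_elem_diff // graft_node /elem_diff_lin /node_lin fglift_comp.
rewrite (eq_fglift (g := fun v : forest d => nabla (sigma i) x [seq Y u x | u <- v])); last first.
  by move=> v; rewrite fglift1 elem_diff_node.
rewrite fgliftD fglift1 nabla_elem_diff_msetD //; congr (_ + _).
rewrite /graft_forest fglift_sum big_seq [RHS]big_seq; apply: eq_bigr => u uw.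
rewrite -IH // nabla_fglift // fglift_comp; apply: eq_fglift => t.
by rewrite fglift1 nabla_elem_diff_msetD.
Qed.

Lemma derive_elem_diff_lin (A : {freeg (tree d) / R}) x v :
  'D_v (elem_diff_lin sigma A) x = fglift (fun t => 'D_v (Y t) x) A.
Proof.
rewrite fglift_dom.
have -> : elem_diff_lin sigma A = fun y => \sum_(k <- dom A) coeff k A *: Y k y.
  by apply/funext => y; rewrite /elem_diff_lin fglift_dom.
have dY k : is_derive x v (fun y => coeff k A *: Y k y) (coeff k A *: 'D_v (Y k) x).
  apply: is_deriveZ; apply: derivableP.
  exact/smooth_coords_derivable/smooth_coords_elem_diff.
by have [_ ->] := is_derive_sum_seq (dom A) dY.
Qed.

Lemma elem_diff_lin_fgraft (w : forest d) (t : tree d) x :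
  elem_diff_lin sigma (fgraft w t) x = nabla (Y t) x [seq Y u x | u <- w].
Proof.
have sF := smooth_coords_elem_diff t.
have [k] := ubnP (size w); elim: k w x => // k IH w x.
elim/(@forest_ind d): w => [_|s w _].
  rewrite fgraft0 /elem_diff_lin fglift1 enum_mset0.
  by apply/rowP => j; rewrite nabla_coord.
rewrite size_mset_cons ltnS => ltw; rewrite fgraftD nabla_elem_diff_msetD //.
rewrite /elem_diff_lin fgliftB !fglift_comp.
(* The induction hypothesis is used at every point [y], since the identity is about to be
   differentiated. *)
have E : elem_diff_lin sigma (fgraft w t) = fun y => nabla (Y t) y [seq Y u y | u <- w].
  by apply/funext => y; exact: IH.
rewrite (eq_fglift _ (fun u => elem_diff_lin_graft s u x)) -derive_elem_diff_lin E.
rewrite derive_nabla_elem_diff //; apply/eqP; rewrite subr_eq; apply/eqP; congr (_ + _).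
rewrite (eq_fglift_forest (g := fun v : forest d => nabla (Y t) x [seq Y u x | u <- v])); last first.
  by move=> v sz; apply: IH; rewrite sz.
rewrite /graft_forest fglift_sum; apply: eq_bigr => u _.
rewrite -elem_diff_lin_graft nabla_fglift // fglift_comp; apply: eq_fglift => u'.
by rewrite fglift1 nabla_elem_diff_msetD.
Qed.

End ElementaryDifferentialsOfGrafts.

(** * Sums over forests *)

Section ForestSums.
Context {d : nat}.
Implicit Types (t : tree d) (v w : forest d).

(** Moves a condition from the index set to the summation, where sums can be exchanged. *)
Lemma sum_fset_set_cond (K : choiceType) (V : nmodType) (A B : set K) (P : pred K)
    (F : K -> V) :
  finite_set A -> (forall x, B x <-> A x /\ P x) ->
  \sum_(x <- fset_set B) F x = \sum_(x <- fset_set A | P x) F x.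
Proof.
move=> finA BAP; rewrite -[RHS]big_filter; apply: perm_big; apply: uniq_perm.
- exact: fset_uniq.
- by rewrite filter_uniq // fset_uniq.
have finB : finite_set B by apply: sub_finite_set finA => x /BAP[].
move=> x; rewrite mem_filter !in_fset_set //.
apply/idP/andP => [/set_mem/BAP[Ax ->]|[Px /set_mem Ax]]; last exact/mem_set/BAP.
by split=> //; exact: mem_set.
Qed.

Lemma fvert_msetD1 t w : fvert (t +` w) = (nvert t + fvert w)%N.
Proof. by rewrite fvertD /fvert big_mset1. Qed.

Lemma size_le_fvert w : (size w <= fvert w)%N.
Proof. by rewrite /fvert -sum1_size; apply: leq_sum => t _; exact: nvert_gt0. Qed.

Lemma nvert_le_fvert t w : t \in w -> (nvert t <= fvert w)%N.
Proof. by move=> tw; rewrite /fvert (big_rem t) //= leq_addr. Qed.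

Lemma forest_sym0 : forest_sym (mset0 : forest d) = 1%N.
Proof. by rewrite /forest_sym big_seq big_pred0 // => t; rewrite msuppE in_mset0. Qed.

Lemma forest_sym_msetD1 t w : forest_sym (t +` w) = ((w t).+1 * forest_sym w)%N.
Proof.
have sub : (finsupp w `<=` finsupp (t +` w))%fset.
  by apply/fsubsetP => u; rewrite !msuppE in_mset1D => ->; rewrite orbT.
have tD : t \in finsupp (t +` w) by rewrite msuppE mset1D1.
(* Both products are taken over the larger support; a tree absent from [w] contributes [0! = 1].
   Then only the factor at [t] differs. *)
have -> : forest_sym w = (\prod_(u <- finsupp (t +` w)) (w u)`!)%N.
  by apply: big_fset_incl => // u _ /fsfun_dflt ->.
rewrite /forest_sym !(big_fsetD1 t tD) /= mset1DE eqxx add1n factS -!mulnA.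
congr (_ * (_ * _))%N; rewrite big_seq [RHS]big_seq; apply: eq_bigr => u.
by rewrite in_fsetD1 => /andP[/negPf ut _]; rewrite mset1DE ut.
Qed.

Lemma mem_fset_forests_upto m w : (w \in fset_set (forests_upto m)) = (fvert w <= m)%N.
Proof.
by rewrite in_fset_set; [apply/idP/idP => [/set_mem|/mem_set] | exact: finite_forests_upto].
Qed.

Lemma mem_fset_trees_upto m t : (t \in fset_set (trees_upto m)) = (nvert t <= m)%N.
Proof.
by rewrite in_fset_set; [apply/idP/idP => [/set_mem|/mem_set] | exact: finite_trees_upto].
Qed.

Lemma size_forest_sum m w : (fvert w <= m)%N ->
  size w = (\sum_(t <- fset_set (trees_upto m)) w t)%N.
Proof.
move=> wm; rewrite size_mset; apply: big_fset_incl => [|t _ /fsfun_dflt //].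
apply/fsubsetP => t; rewrite msuppE mem_fset_trees_upto => /nvert_le_fvert tw.
exact: leq_trans tw wm.
Qed.

(* A forest v arises as t w in size v ways, counted with multiplicity. *)
Lemma sum_forest_msetD1 (R : numFieldType) (m : nat) (F : forest d -> R) :
  \sum_(w <- fset_set (forests_upto m)) \sum_(t <- fset_set (trees_upto (m - fvert w)))
     (forest_sym w)%:R^-1 * F (t +` w)
  = \sum_(v <- fset_set (forests_upto m)) (forest_sym v)%:R^-1 * (size (v : forest d))%:R * F v.
Proof.
pose S := fset_set (@forests_upto d m); pose T := fset_set (@trees_upto d m).
(* Fixing [t] outside: for [|w| <= m] the bound on [t] reads [|t| + |w| <= m], which is symmetric in
   the two indices. *)
transitivity (\sum_(t <- T) \sum_(w <- S | (nvert t + fvert w <= m)%N)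
    (forest_sym w)%:R^-1 * F (t +` w)).
  rewrite [RHS](exchange_big_dep xpredT) //=.
  rewrite big_seq [RHS]big_seq; apply: eq_bigr => w; rewrite mem_fset_forests_upto => wm.
  apply: sum_fset_set_cond; first exact: finite_trees_upto.
  move=> t; rewrite /trees_upto /= leq_subRL // addnC; split=> [tm|[]//].
  by split=> //; apply: leq_trans tm; exact: leq_addr.
transitivity (\sum_(t <- T) \sum_(v <- S) (forest_sym v)%:R^-1 * (v t)%:R * F v); last first.
  rewrite exchange_big /= big_seq [RHS]big_seq; apply: eq_bigr => v.
  rewrite mem_fset_forests_upto => vm.
  by rewrite -mulr_suml -mulr_sumr -natr_sum -size_forest_sum.
apply: eq_bigr => t _.
transitivity (\sum_(v <- S | t \in (v : forest d)) (forest_sym v)%:R^-1 * (v t)%:R * F v); last first.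
  rewrite big_mkcond; apply: eq_bigr => v _; case: ifPn => //.
  by rewrite -msuppE => /fsfun_dflt ->; rewrite mulr0 mul0r.
rewrite -[RHS]big_filter.
(* For fixed [t], adding [t] is a bijection from the forests with [|t| + |w| <= m] onto the forests
   with at most [m] vertices that contain [t]; its inverse removes one copy of [t]. *)
rewrite [RHS](perm_big [seq t +` w | w <- [seq w <- S | (nvert t + fvert w <= m)%N]]) /=; last first.
  apply: uniq_perm; first by rewrite filter_uniq // fset_uniq.
    rewrite map_inj_uniq ?filter_uniq ?fset_uniq // => v w /(congr1 (fun x => x `\ t)).
    by rewrite !msetD1K.
  move=> v; rewrite mem_filter mem_fset_forests_upto; apply/andP/mapP => [[tv vm]|[w]].
    exists (v `\ t); last by rewrite msetB1K.
    have E : fvert v = (nvert t + fvert (v `\ t))%N by rewrite -fvert_msetD1 msetB1K.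
    rewrite mem_filter mem_fset_forests_upto -E vm /=.
    by apply: leq_trans vm; rewrite E leq_addl.
  by rewrite mem_filter => /andP[tw _] ->; rewrite mset1D1 fvert_msetD1.
rewrite big_map big_filter; apply: eq_bigr => w _.
rewrite forest_sym_msetD1 mset1DE eqxx natrM invfM add1n.
by rewrite [_^-1 / _ * _]mulrAC mulVf ?mul1r // pnatr_eq0.
Qed.

End ForestSums.

(** * Integration over the unit interval *)

Section IntegralOverUnitInterval.
Context {R : realType}.

Lemma continuous_sum_seq (I : Type) (s : seq I) (h : I -> R -> R) :
  (forall i, continuous (h i)) -> continuous (fun r => \sum_(i <- s) h i r).
Proof.
move=> ch r; elim: s => [|k s IH].
  by under eq_fun do rewrite big_nil; exact: cvg_cst.
by under eq_fun do rewrite big_cons; exact: (cvgD (ch k r) IH).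
Qed.

Lemma is_derive_continuous (F F' : R -> R) :
  (forall r : R, is_derive r 1 F (F' r)) -> continuous F.
Proof.
by move=> dF r; apply/differentiable_continuous/derivable1_diffP; case: (dF r).
Qed.

Lemma Rintegral01_sum (I : Type) (s : seq I) (h : I -> R -> R) :
  (forall i, continuous (h i)) ->
  \int[lebesgue_measure]_(r in `[0, 1]%classic) (\sum_(i <- s) h i r) =
  \sum_(i <- s) \int[lebesgue_measure]_(r in `[0, 1]%classic) h i r.
Proof.
have cint (f : R -> R) : continuous f ->
    lebesgue_measure.-integrable `[0, 1]%classic (EFin \o f).
  move=> cf; apply: continuous_compact_integrable; first exact: segment_compact.
  exact: continuous_subspaceT.
move=> ch; elim: s => [|i s IH].
  by under eq_Rintegral => r _ do rewrite big_nil; rewrite big_nil Rintegral_cst // mul0r.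
under eq_Rintegral => r _ do rewrite big_cons.
rewrite RintegralD //; [by rewrite big_cons IH | exact: cint |].
by apply: cint; exact: continuous_sum_seq.
Qed.

Lemma Rintegral01_derive (F f : R -> R) :
  (forall r : R, is_derive r 1 F (f r)) -> continuous f ->
  \int[lebesgue_measure]_(r in `[0, 1]%classic) f r = F 1 - F 0.
Proof.
move=> dF cf.
have cF := is_derive_continuous dF.
rewrite /Rintegral (@continuous_FTC2 _ f F) //.
- exact: continuous_subspaceT.
- split; first by move=> r _; case: (dF r).
  + exact: cvg_at_right_filter (cF 0).
  + exact: cvg_at_left_filter (cF 1).
- by move=> r _; rewrite derive1E; case: (dF r).
Qed.

End IntegralOverUnitInterval.

(** * Taylor expansion indexed by forests *)

Section TaylorExpansionOverForests.
Context {R : realType} {n d : nat}.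
Implicit Types (f : 'rV[R]_n -> R) (v x z : 'rV[R]_n).

Lemma is_derive_onem_exp (k : nat) (r : R) :
  is_derive r 1 (fun s : R => (1 - s) ^+ k) (- (k%:R * (1 - r) ^+ k.-1)).
Proof.
have d1 : is_derive r 1 (fun s : R => 1 - s) (-1).
  by rewrite -sub0r; apply: is_deriveB.
have := is_deriveX k d1; rewrite [_ *: -1]mulrN1.
(* [is_deriveX] speaks of a power in the ring of functions, which is here identified with the
   pointwise power. *)
rewrite (_ : (fun s : R => 1 - s) ^+ k = fun s : R => (1 - s) ^+ k) //.
by apply/funext => s; elim: k => [|k IH]; rewrite ?expr0 // !exprS -IH.
Qed.

Lemma is_derive_segment f x z (r : R) : smooth1 f ->
  is_derive r 1 (fun s : R => f (x + s *: z)) ('D_z f (x + r *: z)).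
Proof.
move=> sf; under eq_fun => s do rewrite addrC.
by rewrite [x + _]addrC; apply: is_derive_line; exact: smooth1_derivable.
Qed.

Variables (m : nat) (a : tree d -> 'rV[R]_n).
Local Notation A w := [seq a t | t <- (w : forest d)].
Local Notation S := (fset_set (@forests_upto d m)).

(** Stated for a scalar [f] and arbitrary vectors [a t]: only calculus and the combinatorics of
    forests enter. It is later applied to the coordinates of an elementary differential. *)
Lemma taylor_forests f x z : smooth1 f ->
  f (x + z) - \sum_(w <- S) (forest_sym w)%:R^-1 * iter_derive (A w) f x =
  \sum_(w <- S) \int[lebesgue_measure]_(r in `[0, 1]%classic)
    ((1 - r) ^+ size (w : forest d) / (forest_sym w)%:R *
     iter_derive ((z - \sum_(t <- fset_set (trees_upto (m - fvert w))) a t) :: A w) f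
       (x + r *: z)).
Proof.
move=> sf.
pose c (w : forest d) : R := (forest_sym w)%:R^-1.
pose g (w : forest d) (r : R) := iter_derive (A w) f (x + r *: z).
(* [G] interpolates between the forest sum at [r = 0] and [f (x + z)] at [r = 1]; its derivative
   will be the sum of the integrands [I w]. *)
pose G (r : R) := \sum_(w <- S) c w * ((1 - r) ^+ size (w : forest d) * g w r).
pose res (w : forest d) := z - \sum_(t <- fset_set (trees_upto (m - fvert w))) a t.
pose I (w : forest d) (r : R) : R := (1 - r) ^+ size (w : forest d) / (forest_sym w)%:R *
  iter_derive (res w :: A w) f (x + r *: z).
have dseg vs (r : R) : is_derive r 1 (fun s : R => iter_derive vs f (x + s *: z))
    (iter_derive (z :: vs) f (x + r *: z)).
  exact/is_derive_segment/smooth1_iter_derive.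
have cI w : continuous (I w).
  have c1 := is_derive_continuous (is_derive_onem_exp (size w)).
  have c2 := is_derive_continuous (dseg (res w :: A w)).
  by move=> r; exact: (cvgM (cvgM (c1 r) (cvg_cst _)) (c2 r)).
have dG (r : R) : is_derive r 1 G (\sum_(w <- S) I w r).
  have dGw w := is_deriveZ (c w) (is_deriveM (is_derive_onem_exp (size w) r) (dseg (A w) r)).
  have := is_derive_sum_seq S dGw.
  congr is_derive.
  pose Phi (v : forest d) := (1 - r) ^+ (size v).-1 * g v r.
  have E (w : forest d) : I w r = c w * ((1 - r) ^+ size w * iter_derive (z :: A w) f (x + r *: z))
      - \sum_(t <- fset_set (trees_upto (m - fvert w))) c w * Phi (t +` w).
    rewrite /I /res iter_derive_subl // iter_derive_suml // mulrBr mulr_sumr.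
    rewrite [_ / _]mulrC -!mulrA; congr (_ - _); apply: eq_bigr => t _.
    rewrite /Phi size_mset_cons -!mulrA; congr (_ * (_ * _)).
    by rewrite /g (iter_derive_perm sf (perm_map a (perm_enum_msetD1 t w))).
  rewrite (eq_bigr _ (fun w _ => E w)) sumrB sum_forest_msetD1 -sumrB.
  apply: eq_bigr => w _.
  rewrite -[LHS]/(c w * (_ * _ + _ * - (_ * _))) mulrDr !mulrN; congr (_ - _).
  by rewrite -[RHS]mulrA; congr (_ * _); rewrite mulrC -mulrA.
rewrite -(Rintegral01_sum _ cI) (Rintegral01_derive dG (@continuous_sum_seq _ _ S I cI)).
congr (_ - _).
  (* At [r = 1] every power of [1 - r] vanishes except the zeroth, so only the empty forest
     contributes. *)
  have S0 : mset0 \in S by rewrite mem_fset_forests_upto /fvert enum_mset0 big_nil.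
  rewrite /G (big_fsetD1 mset0 S0) /= big_seq big1 => [|w]; last first.
    rewrite in_fsetD1 => /andP[/negPf w0 _].
    by rewrite subrr expr0n size_mset_eq0 w0 mul0r mulr0.
  rewrite /c forest_sym0 invr1 size_mset0 /g enum_mset0 /=.
  by rewrite expr0 !mul1r scale1r addr0.
by apply: eq_bigr => w _; rewrite subr0 expr1n mul1r /g scale0r addr0.
Qed.

End TaylorExpansionOverForests.

(** * Multiplicative functionals and the expansion of elementary differentials *)

Lemma multiplicative_upto_prod (R : realType) (d m : nat) (X : forest d -> R)
    (w : forest d) :
  multiplicative_upto m X -> (fvert w <= m)%N -> X w = \prod_(t <- w) X [mset t].
Proof.
move=> [X0 XM]; elim/(@forest_ind d): w => [|t w IH] tw.
  by rewrite enum_mset0 big_nil.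
rewrite XM // (perm_big _ (perm_enum_msetD1 t w)) big_cons IH //.
by move: tw; rewrite fvert_msetD1; apply: leq_trans; exact: leq_addl.
Qed.

Theorem theorem3p2 (R : realType) (n d m : nat)
    (sigma : 'I_d -> 'rV[R]_n -> 'rV[R]_n) (z1 z2 : 'rV[R]_n)
    (tau : tree d) (X : forest d -> R) :
  (forall j : 'I_d, smooth (sigma j)) ->
  multiplicative_upto m X ->
  let z := zbracket sigma z1 z2 X in
  elem_diff sigma tau z2 -
    \sum_(w \in forests_upto m)
      (X w / (forest_sym w)%:R) *: elem_diff_lin sigma (fgraft w tau) z1
  = \sum_(0 <= k < m.+1)
      \sum_(w \in [set w : forest d | forests_upto m w /\ size w = k]%classic)
        integral01 (fun r : R =>
          ((1 - r) ^+ k / (forest_sym w)%:R) *: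
          nabla (elem_diff sigma tau) (z1 + r *: z 1%N)
            (z (m.+1 - fvert w)%N :: elem_diff_weights sigma z1 X w)).
Proof.
move=> ssigma Xmul z.
have sY := smooth_coords_elem_diff ssigma tau.
have z1E : z 1%N = z2 - z1.
  rewrite /z /zbracket (_ : trees_upto 0 = set0) ?fsbig_set0 ?subr0 //.
  apply/seteqP; split=> t //=.
  by rewrite /trees_upto /= leqNgt nvert_gt0.
(* For [|w| <= m] the subtraction is not truncated, and the predecessor inside [zbracket] turns
   [m + 1 - |w|] into the tree bound [m - |w|]. *)
have zE (w : forest d) : (fvert w <= m)%N -> z (m.+1 - fvert w)%N = z2 - z1 -
    \sum_(t <- fset_set (trees_upto (m - fvert w))) X [mset t] *: elem_diff sigma t z1.
  by move=> wm; rewrite /z /zbracket subSn // fsbig_finite //; exact: finite_trees_upto.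
apply/rowP => j.
have := taylor_forests m (fun t => X [mset t] *: elem_diff sigma t z1) z1 (z2 - z1) (sY j).
rewrite [z1 + (z2 - z1)]addrC subrK => taylor.
rewrite fsbig_finite; last exact: finite_forests_upto.
rewrite !mxE summxE; apply: etrans (etrans taylor _).
  congr (_ - _); rewrite big_seq [RHS]big_seq; apply: eq_bigr => w.
  rewrite mem_fset_forests_upto => wm.
  (* Multilinearity pulls the scalars [X [mset t]] out of the slots, and multiplicativity collects
     them into [X w]. *)
  rewrite mxE elem_diff_lin_fgraft // nabla_coord // iter_derive_scale_all //.
  by rewrite (multiplicative_upto_prod Xmul wm) mulrAC mulrC.
rewrite summxE.
transitivity (\sum_(0 <= k < m.+1)
    \sum_(w <- fset_set (@forests_upto d m) | size (w : forest d) == k)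
    \int[lebesgue_measure]_(r in `[0, 1]%classic)
    ((1 - r) ^+ size (w : forest d) / (forest_sym w)%:R *
     iter_derive (z (m.+1 - fvert w)%N :: elem_diff_weights sigma z1 X w)
       (fun x => elem_diff sigma tau x 0 j) (z1 + r *: (z2 - z1)))).
  rewrite (exchange_big_dep xpredT) //= big_seq [RHS]big_seq.
  apply: eq_bigr => w; rewrite mem_fset_forests_upto => wm.
  under [RHS]eq_bigl => k do rewrite eq_sym.
  (* Every tree has a vertex, so [size w <= fvert w <= m]: each forest is counted for exactly one
     [k] in the range. *)
  rewrite big_nat1_eq ltnS (leq_trans (size_le_fvert w) wm) /=.
  by rewrite zE.
apply: eq_bigr => k _.
pose Bk := [set w : forest d | forests_upto m w /\ size w = k]%classic.
have finB : finite_set Bk.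
  by apply: sub_finite_set (@finite_forests_upto d m) => w [].
rewrite -(sum_fset_set_cond (B := Bk)); last 2 first.
- exact: finite_forests_upto.
- by move=> w; split=> -[wm /eqP wk].
rewrite (fsbig_finite _ _ finB) [RHS]summxE big_seq [RHS]big_seq; apply: eq_bigr => w.
rewrite in_fset_set // => /set_mem[_ wk].
rewrite mxE; apply: eq_Rintegral => r _.
by rewrite [RHS]mxE nabla_coord // z1E wk.
Qed.
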